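(* Let $X$ be a topological space and let $\kappa > \lambda \ge \omega$ be cardinals such that $(\kappa,\lambda)$ is a pinning down pair for $X$. Assume moreover that $$|X| \le \kappa = \operatorname{cof}\big([\kappa]^{\lambda}, \subset\big).$$ Then $d(X) \le \lambda$.
   Context: No separation axioms are assumed. For cardinals $\kappa > \lambda \ge \omega$, $(\kappa,\lambda)$ is a pinning down pair for a topological space $X$ if for every family $\mathcal{U}$ of non-empty open sets in $X$ with $|\mathcal{U}| \le \kappa$ there is $B \subset X$ with $|B| \le \lambda$ such that $B \cap U \ne \emptyset$ for each $U \in \mathcal{U}$. $d(X)$ denotes the density of $X$ (smallest cardinality of a dense subset). $[\kappa]^\lambda$ is the set of all subsets of $\kappa$ of cardinality $\lambda$, and $\operatorname{cof}([\kappa]^\lambda,\subset)$ is the smallest cardinality of a family $\mathcal{A} \subset [\kappa]^\lambda$ such that every member of $[\kappa]^\lambda$ is included in some member of $\mathcal{A}$. *)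

(* Defs.v *)
From mathcomp Require Import all_boot all_order.
From mathcomp Require Import boolp classical_sets functions cardinality topology.

Set Implicit Arguments.
Unset Strict Implicit.
Unset Printing Implicit Defensive.

Local Open Scope classical_set_scope.
Local Open Scope card_scope.

(* Cardinals are represented by types: a type K stands for the cardinality of
   [set: K], and cardinals are compared with #<= and #= from cardinality.v. *)

Definition card_lt T U (A : set T) (B : set U) : Prop :=
  A #<= B /\ ~ (B #<= A).
Notation "A '#<' B" := (card_lt A B)
  (at level 79, format "A  '#<'  B") : card_scope.

(* The smallest cardinality of a member of F, represented by a chosen member
   of F of that cardinality; least_cardP shows that one exists as soon as F is
   nonempty. *)
Definition least_card T (F : set (set T)) : set T :=
  get [set A | F A /\ forall B, F B -> A #<= B].

Lemma homo_inj_card_le T U (A : set T) (B : set U) (f : T -> U) :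
  (forall x, A x -> B (f x)) ->
  (forall x y, A x -> A y -> f x = f y -> x = y) -> A #<= B.
Proof.
move=> fAB finj.
have [g] : $|{injfun A >-> B}|.
  apply/injfunPex; exists f => //.
  by move=> x y /set_mem Ax /set_mem Ay; exact: finj.
exact: inj_card_le g.
Qed.

Lemma least_cardP T (F : set (set T)) : F !=set0 ->
  F (least_card F) /\ forall B, F B -> least_card F #<= B.
Proof.
move=> [A0 FA0].
suff : exists A, F A /\ forall B, F B -> A #<= B by exact: getPex.
(* Zorn, on sets of choice functions for F that pairwise differ everywhere. *)
pose good (S : set (set T -> T)) :=
  (forall f A, S f -> F A -> A (f A)) /\
  (forall f g A, S f -> S g -> F A -> f A = g A -> f = g).
have [G Ggood Gtot|S [[Sch Sinj] Smax]] := @Zorn_bigcup _ good.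
  split=> [f A [S GS Sf]|f g A [S GS Sf] [S' GS' S'g]].
    exact: (Ggood _ GS).1.
  by have [SS'|S'S] := Gtot _ _ GS GS';
    [apply: (Ggood _ GS').2 => //; exact: SS'
    |apply: (Ggood _ GS).2 => //; exact: S'S].
have [[A [FA AS]]|noA] :=
    pselect (exists A, F A /\ forall x, A x -> exists2 f, S f & f A = x).
  exists A; split=> // B FB.
  have /choice[h hP] x : exists f, A x -> S f /\ f A = x.
    have [Ax|nAx] := pselect (A x); last by exists (fun=> x).
    by have [f Sf fA] := AS x Ax; exists f.
  apply: (@homo_inj_card_le _ _ A B (fun x => h x B)) => [x Ax|x y Ax Ay hxy].
    by have [Sh _] := hP x Ax; exact: (Sch (h x) B).
  have [[Shx <-] [Shy <-]] := (hP x Ax, hP y Ay).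
  by rewrite (Sinj _ _ _ Shx Shy FB hxy).
exfalso.
have new A : F A -> exists x, A x /\ forall f, S f -> f A <> x.
  move=> FA; apply: contrapT => nx; apply: noA; exists A; split=> // x Ax.
  apply: contrapT => nf; apply: nx; exists x; split=> // f Sf fA.
  by apply: nf; exists f.
have [x0 _] := new _ FA0.
have /choice[h hP] A : exists x, F A -> A x /\ forall f, S f -> f A <> x.
  have [/new[x ?]|nFA] := pselect (F A); first by exists x.
  by exists x0.
refine (Smax (S `|` [set h]) _ _).
  split=> [|sub]; first by move=> f Sf; left.
  exact: (hP _ FA0).2 h (sub h (or_intror erefl)) erefl.
split=> [f A [Sf|->] FA|f g A [Sf|->] [Sg|->] FA fgA //].
- exact: (Sch f A).
- exact: (hP A FA).1.
- exact: Sinj fgA.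
- by case: ((hP A FA).2 f Sf).
- by case: ((hP A FA).2 g Sg).
Qed.

Definition subsets_of_card (K L : Type) : set (set K) :=
  [set A | A #= [set: L]].

Definition cofinal_family (K L : Type) (F : set (set K)) : Prop :=
  F `<=` @subsets_of_card K L /\
  forall A, subsets_of_card L A -> exists2 B, F B & A `<=` B.

(* cof([K]^L, subset), as a family realizing it. *)
Definition cof_subsets (K L : Type) : set (set K) :=
  least_card (@cofinal_family K L).

Lemma cof_subsetsP (K L : Type) : cofinal_family L (@cof_subsets K L) /\
  forall F, @cofinal_family K L F -> @cof_subsets K L #<= F.
Proof.
by apply: least_cardP; exists (@subsets_of_card K L); split=> // A ?; exists A.
Qed.

(* d(X), as a dense subset realizing it. *)
Definition density (X : topologicalType) : set X := least_card (@dense X).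

Lemma densityP (X : topologicalType) : dense (@density X) /\
  forall D : set X, dense D -> @density X #<= D.
Proof. by apply: least_cardP; exists setT => U U0 _; rewrite setIT. Qed.

Definition pinning_down_pair (K L : Type) (X : topologicalType) : Prop :=
  forall U : set (set X),
    (forall V, U V -> open V /\ V !=set0) -> U #<= [set: K] ->
    exists2 B : set X, B #<= [set: L] & forall V, U V -> B `&` V !=set0.

Arguments subsets_of_card : clear implicits.
Arguments cofinal_family : clear implicits.
Arguments cof_subsets : clear implicits.
Arguments density : clear implicits.

(* Main.v *)
Require Import Defs.
From mathcomp Require Import all_boot all_order.
From mathcomp Require Import boolp classical_sets functions cardinality topology.
Local Open Scope classical_set_scope.
Local Open Scope card_scope.

(* If no set of cardinality at most lambda is dense, every member A of a
   cofinal family in [kappa]^lambda (with X embedded in kappa) misses some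
   nonempty open set U_A.  There are only kappa such U_A, so they are all met
   by some B with |B| <= lambda; but B is contained in some A, hence misses
   U_A. *)

Lemma card_le_homo_inj {T U : Type} (u0 : U) {A : set T} {B : set U} :
  A #<= B -> exists f : T -> U,
    (forall x, A x -> B (f x)) /\
    (forall x y, A x -> A y -> f x = f y -> x = y).
Proof.
move=> /card_leP[f].
have : $|{injfun A >-> B}| by squash (valLR u0 f).
move=> /injfunPex[g gAB ginj]; exists g; split=> // x y Ax Ay.
by apply: ginj; exact: mem_set.
Qed.

(** Two injections are glued, points of [A1] following the first even when they also lie in [A2].
    Disjointness of [B1] and [B2] keeps the two branches from colliding. *)
Lemma card_leU2 {T U : Type} {A1 A2 : set T} {B1 B2 : set U} :
  B1 `&` B2 = set0 -> A1 #<= B1 -> A2 #<= B2 ->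
  A1 `|` A2 #<= B1 `|` B2.
Proof.
move=> B12 A1B1 A2B2.
have [[u0 _]|U0] := pselect (exists u : U, True); last first.
  have U_eq0 (B : set U) : B = set0.
    by apply/seteqP; split=> // u _; apply: U0; exists u.
  move: A1B1 A2B2; rewrite (U_eq0 B1) (U_eq0 B2) => /card_le0P-> /card_le0P->.
  by rewrite setU0 card_ge0.
have [f1 [f1B f1inj]] := card_le_homo_inj u0 A1B1.
have [f2 [f2B f2inj]] := card_le_homo_inj u0 A2B2.
have f2B' x : (A1 `|` A2) x -> ~ A1 x -> B2 (f2 x).
  by move=> [//|A2x] _; exact: f2B.
have disj u : B1 u -> B2 u -> False.
  by move=> B1u B2u; have : (B1 `&` B2) u by []; rewrite B12.
apply: (@homo_inj_card_le _ _ _ _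
  (fun x => if pselect (A1 x) then f1 x else f2 x)) => [x Ax|x y Ax Ay].
  by case: pselect => A1x; [left; exact: f1B|right; exact: f2B'].
case: pselect => A1x; case: pselect => A1y.
- by move=> /=; exact: f1inj.
- by move=> /= e; case: (disj (f1 x)); [exact: f1B|rewrite e; exact: f2B'].
- by move=> /= e; case: (disj (f1 y)); [exact: f1B|rewrite -e; exact: f2B'].
- by move=> /=; case: Ax Ay => [//|Ax] [//|Ay]; exact: f2inj.
Qed.

(** One of the two members of the family [[set A; B]] has least cardinality. *)
Lemma card_le_total {T : Type} (A B : set T) : A #<= B \/ B #<= A.
Proof.
have [|[->|->] leAB] := @least_cardP T [set A; B]; first by exists A; left.
- by left; apply: leAB; right.
- by right; apply: leAB; left.
Qed.

(** With [S'] a copy of [S] inside [L], it suffices to add to [S] a copy of the complement of [S']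
    taken outside [S]; there is room because [K] does not inject into [L]. *)
Lemma card_le_superset {K L : Type} {S : set K} :
  [set: L] #< [set: K] -> S #<= [set: L] ->
  exists2 C, subsets_of_card K L C & S `<=` C.
Proof.
move=> [LK nKL] /card_subP[S' S'S _].
have /card_eqPle[S'leS SleS'] := S'S.
(* The complement of [S'] is copied into [K] because [card_le_total] compares subsets of one
   type. *)
have /card_subP[D D_eq _] : ~` S' #<= [set: K].
  exact: card_le_trans (card_leT _) LK.
have /card_eqPle[DleS' S'leD] := D_eq.
have [/card_subP[E E_eq ES]|SD] := card_le_total D (~` S); last first.
  (* Gluing ~` S into ~` S' onto S #= S' would inject K into L. *)
  case: nKL; rewrite -(setUv S) -(setUv S').
  apply: card_leU2 => //; first exact: setICr.
  exact: card_le_trans SD DleS'.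
have /card_eqPle[EleD DleE] := E_eq.
exists (S `|` E); last by move=> x; left.
apply/card_eqPle; rewrite -(setUv S'); split.
  apply: card_leU2 => //; first exact: setICr.
  exact: card_le_trans EleD DleS'.
apply: card_leU2 => //; last exact: card_le_trans S'leD DleE.
by apply/seteqP; split=> // x [Sx /ES].
Qed.

Theorem theorem2p1 (X : topologicalType) (K L : Type) :
  [set: nat] #<= [set: L] ->
  [set: L] #< [set: K] ->
  pinning_down_pair K L X ->
  [set: X] #<= [set: K] ->
  [set: K] #= cof_subsets K L ->
  density X #<= [set: L].
Proof.
move=> _ LK pin XK /card_eqPle[_ FK].
have [[Fcard Fcof] _] := cof_subsetsP K L.
apply: contrapT => nd.
(* [k0] is the default value that lets [card_le_homo_inj] return a total map into [K]. *)
have [k0 _] : exists k : K, True.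
  apply: contrapT => K0; apply: LK.2.
  have -> : [set: K] = set0 by apply/seteqP; split=> // k _; apply: K0; exists k.
  exact: card_ge0.
have [f [_ finj]] := card_le_homo_inj k0 XK.
have /choice[U UP] A : exists O : set X, cof_subsets K L A ->
    [/\ open O, O !=set0 & O `&` f @^-1` A = set0].
  have [FA|nFA] := pselect (cof_subsets K L A); last by exists set0.
  (* Since [f] is injective, the preimage of [A] is no larger than [A], hence than [L]; were it
     dense, it would bound [density X]. *)
  have /denseNE[O [[x [oO Ox]] OA]] : ~ dense (f @^-1` A).
    move=> /(densityP X).2 dA; apply: nd; apply: card_le_trans dA _.
    have /card_eqPle[AL _] := Fcard _ FA; apply: card_le_trans AL.
    by apply: (@homo_inj_card_le _ _ _ _ f) => // x y _ _; exact: finj.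
  by exists O => _; split=> //; exists x.
have [||B BL BU] := pin (U @` cof_subsets K L).
- by move=> _ [A FA <-]; have [] := UP A FA.
- exact: card_le_trans (card_image_le _ _) FK.
(* Cofinality covers sets of cardinality exactly that of [L], so the image of [B], which may be
   smaller, is first enlarged to [C]. *)
have [C CL BC] := card_le_superset LK (card_le_trans (card_image_le f B) BL).
have [A FA CA] := Fcof C CL.
have [x [Bx Ux]] : B `&` U A !=set0 by apply: BU; exists A.
have [_ _ UA0] := UP A FA.
have : (U A `&` f @^-1` A) x by split=> //; apply/CA/BC; exists x.
by rewrite UA0.
Qed.
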